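(* For all positive integers $k$ and $\ell$, \[ \sum_{b\ge0} J(b,k,\ell)x^b = [z_1^k\cdots z_\ell^k]\left( \frac{1}{1-z_1}\cdots\frac{1}{1-z_\ell}\, D_{z_1,z_2}D_{z_1,z_2,z_3}\cdots D_{z_1,\dots,z_\ell}\, \frac{1}{2-h_k(1,x,xz_1,\dots,xz_\ell)}\right). \]
   Context: A composition is a finite sequence of positive integers; its size is the sum of its parts (the empty sequence is the composition of $0$). Write $[n]=\{1,\dots,n\}$. A (multiplex juggling) card is a triple $(\alpha,\beta,f)$ where $\alpha=(\alpha_1,\dots,\alpha_s)$ and $\beta=(\beta_1,\dots,\beta_t)$ are compositions with $|\alpha|=|\beta|$, and $f:[s]\to\{0\}\cup[t]$ is strictly increasing such that for all $i\in[s]$, if $f(i)\neq0$ then $\alpha_i\le\beta_{f(i)}$; $\alpha$ is the arrival and $\beta$ the departure composition. The card has $|\alpha|$ balls and has capacity $k$ if every part of $\alpha$ and $\beta$ is at most $k$. An $\ell$-card sequence with $b$ balls and capacity $k$ is a sequence $(C_1,\dots,C_\ell)$ of cards with $b$ balls and capacity $k$ such that the departure composition of $C_i$ equals the arrival composition of $C_{i+1}$ for all $i\in[\ell-1]$; $J(b,k,\ell)$ is the number of these. The complete homogeneous symmetric polynomial is $h_n(x_1,\dots,x_m)=\sum_{i_1+\dots+i_m=n}x_1^{i_1}\cdots x_m^{i_m}$ (sum over nonnegative integers), with $h_0=1$. For indeterminates $z_1,\dots,z_m$, $D_{z_1,\dots,z_m}$ is the linear operator on formal power series in $z_m$ (whose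 coefficients may involve the other variables), acting termwise by $D_{z_1,\dots,z_m}z_m^n=h_n(1,z_1,\dots,z_{m-1})z_m^n$. $[z_1^k\cdots z_\ell^k]F$ denotes the coefficient of $z_1^k\cdots z_\ell^k$ in $F$ (a power series in $x$). *)

(* Defs.v *)
From HB Require Import structures.
From mathcomp Require Import all_boot all_order all_algebra.
From mathcomp Require Import boolp mpoly.

Set Implicit Arguments.
Unset Strict Implicit.
Unset Printing Implicit Defensive.

Import GRing.Theory.
Local Open Scope ring_scope.

(* -------------------------------------------------------------------------- *)
(* Formal power series in n commuting variables: {fps R[n]} is the set of all *)
(* families of coefficients indexed by the monomials 'X_{1..n} of mpoly.      *)
(* Equality is extensional, hence the classical eqType / choiceType.          *)
(* -------------------------------------------------------------------------- *)

Record fps (n : nat) (R : Type) := FPS { fcoef : 'X_{1..n} -> R }.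

Arguments FPS {n R}.

Notation "{ 'fps' R [ n ] }" := (fps n R)
  (at level 0, R at level 2, n at level 2, format "{ 'fps'  R [ n ] }").

HB.instance Definition _ n R := gen_eqMixin (fps n R).
HB.instance Definition _ n R := gen_choiceMixin (fps n R).

Lemma fpsP n R (f g : {fps R[n]}) : f = g <-> fcoef f =1 fcoef g.
Proof. by split=> [->//|]; case: f g => f [g] /= /funext ->. Qed.

Section FpsRing.
Variables (n : nat) (R : comNzRingType).
Implicit Types f g h : {fps R[n]}.

Definition fps0 : {fps R[n]} := FPS (fun=> 0).
Definition fps_opp f : {fps R[n]} := FPS (fun m => - fcoef f m).
Definition fps_add f g : {fps R[n]} := FPS (fun m => fcoef f m + fcoef g m).

Fact fps_addA : associative fps_add.
Proof. by move=> f g h; apply/fpsP=> m /=; rewrite addrA. Qed.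
Fact fps_addC : commutative fps_add.
Proof. by move=> f g; apply/fpsP=> m /=; rewrite addrC. Qed.
Fact fps_add0 : left_id fps0 fps_add.
Proof. by move=> f; apply/fpsP=> m /=; rewrite add0r. Qed.
Fact fps_addN : left_inverse fps0 fps_opp fps_add.
Proof. by move=> f; apply/fpsP=> m /=; rewrite addNr. Qed.

HB.instance Definition _ := GRing.isZmodule.Build {fps R[n]}
  fps_addA fps_addC fps_add0 fps_addN.

Definition fpsC (c : R) : {fps R[n]} := FPS (fun m => if m == 0%MM then c else 0).

Definition fps_mul f g : {fps R[n]} := FPS (fun m =>
  \sum_(p : 'X_{1..n < (mdeg m).+1, (mdeg m).+1} | m == (p.1 + p.2)%MM)
     fcoef f p.1 * fcoef g p.2).

(* The polynomial with the terms of f of degree < d; products of series are   *)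
(* computed degree by degree in the polynomial ring.                          *)
Definition ftrunc d f : {mpoly R[n]} :=
  \sum_(m : 'X_{1..n < d}) fcoef f m *: 'X_[m].

Lemma mcoeff_ftrunc d f m : (mdeg m < d)%N -> (ftrunc d f)@_m = fcoef f m.
Proof. exact: (@mcoeff_mpoly n R (fcoef f)). Qed.

Lemma fcoef_mulE f g (p q : {mpoly R[n]}) m :
    (forall u, (mdeg u <= mdeg m)%N -> p@_u = fcoef f u) ->
    (forall u, (mdeg u <= mdeg m)%N -> q@_u = fcoef g u) ->
  fcoef (fps_mul f g) m = (p * q)@_m.
Proof.
move=> hp hq; rewrite mcoeffM /=; apply: eq_bigr => -[a b] _ /=.
by rewrite hp ?hq // -ltnS bmdeg.
Qed.

Fact fps_mulC : commutative fps_mul.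
Proof.
move=> f g; apply/fpsP=> m.
have h (e : {fps R[n]}) u : (mdeg u <= mdeg m)%N ->
    (ftrunc (mdeg m).+1 e)@_u = fcoef e u.
  by move=> hu; apply: mcoeff_ftrunc.
by rewrite (fcoef_mulE (h f) (h g)) (fcoef_mulE (h g) (h f)) mulrC.
Qed.

Fact fps_mulA : associative fps_mul.
Proof.
move=> f g h; apply/fpsP=> m.
have t (e : {fps R[n]}) u : (mdeg u <= mdeg m)%N ->
    (ftrunc (mdeg m).+1 e)@_u = fcoef e u.
  by move=> hu; apply: mcoeff_ftrunc.
have t2 (e1 e2 : {fps R[n]}) u : (mdeg u <= mdeg m)%N ->
    (ftrunc (mdeg m).+1 e1 * ftrunc (mdeg m).+1 e2)@_u
      = fcoef (fps_mul e1 e2) u.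
  by move=> hu; rewrite (@fcoef_mulE e1 e2 (ftrunc (mdeg m).+1 e1) (ftrunc (mdeg m).+1 e2)) // => v hv;
     apply: t; apply: leq_trans hu.
by rewrite (fcoef_mulE (t f) (t2 g h)) (fcoef_mulE (t2 f g) (t h)) mulrA.
Qed.

Fact fps_mul1 : left_id (fpsC 1) fps_mul.
Proof.
move=> f; apply/fpsP=> m.
rewrite (@fcoef_mulE _ _ 1 (ftrunc (mdeg m).+1 f)) ?mul1r ?mcoeff_ftrunc //.
- by move=> u _; rewrite mcoeff1 /=; case: eqP.
- by move=> u hu; rewrite mcoeff_ftrunc.
Qed.

Fact fps_mulDl : left_distributive fps_mul fps_add.
Proof.
move=> f g h; apply/fpsP=> m /=; rewrite -big_split /=.
by apply: eq_bigr => p _; rewrite mulrDl.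
Qed.

Fact fps_oner_neq0 : fpsC 1 != 0.
Proof.
apply/eqP=> /fpsP /(_ 0%MM) /= /eqP.
by rewrite eqxx oner_eq0.
Qed.

HB.instance Definition _ := GRing.Zmodule_isComNzRing.Build {fps R[n]}
  fps_mulA fps_mulC fps_mul1 fps_mulDl fps_oner_neq0.

Definition fpsX (i : 'I_n) : {fps R[n]} :=
  FPS (fun m => if m == U_(i)%MM then 1 else 0).

Lemma fcoef0 m : fcoef (0 : {fps R[n]}) m = 0. Proof. by []. Qed.
Lemma fcoefD f g m : fcoef (f + g) m = fcoef f m + fcoef g m.
Proof. by []. Qed.
Lemma fcoefN f m : fcoef (- f) m = - fcoef f m. Proof. by []. Qed.
Lemma fcoefB f g m : fcoef (f - g) m = fcoef f m - fcoef g m.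
Proof. by []. Qed.
Lemma fcoef1 m : fcoef (1 : {fps R[n]}) m = (m == 0%MM)%:R.
Proof. by rewrite /=; case: eqP. Qed.
Lemma fcoefM f g m : fcoef (f * g) m =
  \sum_(p : 'X_{1..n < (mdeg m).+1, (mdeg m).+1} | m == (p.1 + p.2)%MM)
     fcoef f p.1 * fcoef g p.2.
Proof. by []. Qed.

Lemma fcoef_sum I (r : seq I) (P : pred I) (F : I -> {fps R[n]}) m :
  fcoef (\sum_(i <- r | P i) F i) m = \sum_(i <- r | P i) fcoef (F i) m.
Proof. by elim/big_rec2: _ => // i _ a _ <-. Qed.

Lemma fcoefM0 f g : fcoef (f * g) 0%MM = fcoef f 0%MM * fcoef g 0%MM.
Proof.
have t (e : {fps R[n]}) u : (mdeg u <= mdeg (0 : 'X_{1..n}))%N ->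
    (ftrunc (mdeg (0 : 'X_{1..n})).+1 e)@_u = fcoef e u.
  by move=> hu; apply: mcoeff_ftrunc.
rewrite [LHS](fcoef_mulE (t f) (t g)).
by rewrite rmorphM /= !t.
Qed.

Lemma fcoefCM c f m : fcoef (fpsC c * f) m = c * fcoef f m.
Proof.
rewrite (@fcoef_mulE _ _ c%:MP (ftrunc (mdeg m).+1 f)).
- by rewrite mul_mpolyC mcoeffZ mcoeff_ftrunc.
- by move=> u _; rewrite mcoeffC /=; case: eqP; rewrite ?mulr1 ?mulr0.
- by move=> u hu; rewrite mcoeff_ftrunc.
Qed.

Lemma fcoef_exp_lt f j m :
  fcoef f 0%MM = 0 -> (mdeg m < j)%N -> fcoef (f ^+ j) m = 0.
Proof.
move=> f0; elim: j m => // j IH m lt_mj; rewrite exprS fcoefM big1 //.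
case=> a b /= /eqP def_m; have [a0|a_neq0] := eqVneq (bmnm a) 0%MM.
  by rewrite a0 f0 mul0r.
rewrite IH ?mulr0 //; rewrite -ltnS; apply: leq_trans lt_mj.
have dm : mdeg m = (mdeg a + mdeg b)%N by rewrite -mdegD -def_m.
have a_gt0 : (0 < mdeg a)%N by rewrite lt0n mdeg_eq0.
by move: (leq_add a_gt0 (leqnn (mdeg b))); rewrite -dm.
Qed.

Definition fcst (f : {fps R[n]}) := fcoef f 0%MM.
Fact fcst_is_zmod_morphism : zmod_morphism fcst. Proof. by []. Qed.
Fact fcst_is_monoid_morphism : monoid_morphism fcst.
Proof. by split=> [|f g]; rewrite /fcst ?fcoef1 ?eqxx ?fcoefM0. Qed.
HB.instance Definition _ := GRing.isZmodMorphism.Build {fps R[n]} R fcst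
  fcst_is_zmod_morphism.
HB.instance Definition _ := GRing.isMonoidMorphism.Build {fps R[n]} R fcst
  fcst_is_monoid_morphism.

End FpsRing.

Arguments fpsC {n R}.
Arguments fpsX {n R}.
Arguments fps_mul : simpl never.

Section FpsUnitRing.
Variables (n : nat) (R : comUnitRingType).
Implicit Types f g : {fps R[n]}.

Definition fps_unit : {pred {fps R[n]}} :=
  fun f => fcoef f 0%MM \is a GRing.unit.

(* With c the constant coefficient of f, 1/f = \sum_(j >= 0) (1 - f/c)^j / c; *)
(* the terms with j > mdeg m do not contribute to the coefficient of m.       *)
Definition fps_inv f : {fps R[n]} :=
  let c' := fpsC (fcoef f 0%MM)^-1 in
  if f \in fps_unit then
    FPS (fun m => \sum_(j < (mdeg m).+1) fcoef (c' * (1 - c' * f) ^+ j) m)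
  else f.

Fact fps_mulV : {in fps_unit, left_inverse 1 fps_inv *%R}.
Proof.
move=> f uf; rewrite mulrC; apply/fpsP=> m.
rewrite /fps_inv uf; set c' := fpsC _; set g := 1 - c' * f.
have g0 : fcoef g 0%MM = 0.
  rewrite /g fcoefB fcoefM0 fcoef1 eqxx [fcoef c' _]/= eqxx mulVr ?subrr //.
pose S := c' * \sum_(j < (mdeg m).+1) g ^+ j.
have -> : fcoef (f * FPS (fun m0 =>
      \sum_(j < (mdeg m0).+1) fcoef (c' * g ^+ j) m0)) m = fcoef (f * S) m.
  rewrite [LHS]fcoefM [RHS]fcoefM; apply: eq_bigr => -[a b] _.
  rewrite [fcoef (FPS _) _]/=; congr (_ * _).
  rewrite [LHS]/= /S mulr_sumr fcoef_sum.
  rewrite -(big_mkord xpredT (fun j => fcoef (c' * g ^+ j) b)).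
  rewrite -(big_mkord xpredT (fun j => fcoef (c' * g ^+ j) b)).
  rewrite [RHS](@big_cat_nat _ _ _ (mdeg b).+1) //; last by exact: bmdeg.
  rewrite [X in _ = _ + X]big_nat_cond [X in _ = _ + X]big1 ?addr0 // => j.
  rewrite andbT => /andP[lt_bj _].
  by rewrite /c' fcoefCM fcoef_exp_lt ?mulr0.
have -> : f * S = 1 - g ^+ (mdeg m).+1.
  rewrite /S mulrA [f * c']mulrC.
  have -> : c' * f = 1 - g by rewrite /g subKr.
  rewrite -[X in _ = X - _](expr1n _ (mdeg m).+1) subrXX.
  by congr (_ * _); apply: eq_bigr => j _; rewrite expr1n mul1r.
by rewrite fcoefB fcoef_exp_lt ?subr0.
Qed.

Fact fps_unitPl : forall f g, g * f = 1 -> f \in fps_unit.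
Proof.
move=> f g /(congr1 (fun e => fcoef e 0%MM)); rewrite fcoefM0 fcoef1 eqxx => h.
by apply/unitrPr; exists (fcoef g 0%MM); rewrite mulrC.
Qed.

Fact fps_inv_out : {in [predC fps_unit], fps_inv =1 id}.
Proof. by move=> f /negbTE uf; rewrite /fps_inv [f \in _]uf. Qed.

HB.instance Definition _ := GRing.ComNzRing_hasMulInverse.Build {fps R[n]}
  fps_mulV fps_unitPl fps_inv_out.

Lemma fps_unitE f : (f \is a GRing.unit) = (fcoef f 0%MM \is a GRing.unit).
Proof. by []. Qed.

End FpsUnitRing.

(* The one-variable series \sum_(b >= 0) a_b x^b. *)
Definition genser (R : Type) (a : nat -> R) : {fps R[1]} :=
  FPS (fun m => a (m ord0)).

Definition hsym (R : comNzRingType) (d : nat) (s : seq R) : R :=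
  \sum_(e : {ffun 'I_(size s) -> 'I_d.+1} | (\sum_(i < size s) e i)%N == d)
     \prod_(i < size s) s`_i ^+ e i.

Lemma hsym_morph (R S : comNzRingType) (phi : {rmorphism R -> S}) d s :
  phi (hsym d s) = hsym d (map phi s).
Proof.
rewrite /hsym size_map rmorph_sum; apply: eq_bigr => e _.
rewrite rmorph_prod; apply: eq_bigr => i _.
by rewrite rmorphXn (nth_map 0).
Qed.

Lemma hsym10 (R : comNzRingType) d (s : seq R) :
  all (fun v => v == 0) s -> hsym d (1 :: s) = 1.
Proof.
move=> s0; rewrite /hsym.
pose e0 : {ffun 'I_(size s).+1 -> 'I_d.+1} := [ffun i => if i == ord0 then ord_max else ord0].
have e0E i : e0 i = (if i == ord0 then d else 0%N) :> nat.
  by rewrite ffunE; case: eqP.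
rewrite (bigD1 e0) /=; last first.
  rewrite big_ord_recl e0E eqxx big1 ?addn0 //.
rewrite [X in X + _]big1; last first.
  move=> i _; rewrite e0E; case: eqP => [->|_]; first by rewrite expr1n.
  by rewrite expr0.
rewrite big1 ?addr0 // => e /andP[/eqP se ne].
case: (pickP (fun i : 'I_(size s) => e (lift ord0 i) != ord0)) => [i hi|h].
  have /eqP si := allP s0 _ (mem_nth 0 (ltn_ord i)).
  rewrite (bigD1 (lift ord0 i)) //= si expr0n.
  suff /negbTE -> : e (lift ord0 i) != 0 :> nat by rewrite mul0r.
  by apply: contraNneq hi => h0; apply/eqP/val_inj.
case/eqP: ne; apply/ffunP => i; rewrite /e0 ffunE; case: (unliftP ord0 i) => [j|] ->.
  by have /negbFE/eqP -> := h j.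
apply: val_inj => /=; rewrite -[RHS]se big_ord_recl big1 ?addn0 // => j _.
by have /negbFE/eqP -> := h j.
Qed.

Section DOperator.
Variables (n : nat) (R : comNzRingType).
Implicit Types F : {fps R[n]}.

(* The coefficient of z_i^d in F, a series in the other variables. *)
Definition zcoef (i : 'I_n) (d : nat) F : {fps R[n]} :=
  FPS (fun m => if m i == 0%N then fcoef F (m + U_(i) *+ d)%MM else 0).

(* With 0-based indices, Dop i is D_{z_0,...,z_i}: it maps                    *)
(*   F = \sum_d zcoef i d F * z_i^d                                           *)
(* to \sum_d zcoef i d F * h_d(1, z_0, ..., z_(i-1)) * z_i^d, whose terms     *)
(* with d > m i do not contribute to the coefficient of m.                    *)
Definition Dop (i : 'I_n) F : {fps R[n]} :=
  FPS (fun m => \sum_(d < (m i).+1)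
    fcoef (zcoef i d F
           * (hsym d (1 :: [seq fpsX j | j : 'I_n <- enum 'I_n & (j < i)%N])
              * fpsX i ^+ d)) m).


Lemma fcoefMXn (i : 'I_n) d (f : {fps R[n]}) m :
  fcoef (f * fpsX i ^+ d) m =
    if (d <= m i)%N then fcoef f (m - U_(i) *+ d)%MM else 0.
Proof.
have hX u : (mdeg u <= mdeg m)%N -> ('X_i ^+ d : {mpoly R[n]})@_u = fcoef (fpsX i ^+ d) u.
  elim: d u => [|e IH] u hu; first by rewrite !expr0 mcoeff1 fcoef1.
  rewrite !exprSr [RHS](@fcoef_mulE _ _ _ _ ('X_i ^+ e) 'X_i) // => v hv.
    by rewrite IH // (leq_trans hv).
  by rewrite mcoeffX /= eq_sym; case: eqP.
have hf u : (mdeg u <= mdeg m)%N -> (ftrunc (mdeg m).+1 f)@_u = fcoef f u.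
  by move=> hu; rewrite mcoeff_ftrunc.
rewrite [LHS](fcoef_mulE hf hX) mpolyXn.
move: (ftrunc _ f) hf => p hf; case: ifPn => hd.
  have {1}-> : m = (m - U_(i) *+ d + U_(i) *+ d)%MM.
    rewrite submK //; apply/mnm_lepP => j; rewrite mulmnE mnm1E.
    by case: eqP => [<-|_]; rewrite ?mul1n ?mul0n.
  by rewrite addmC mcoeffMX hf ?mdegB.
rewrite mcoeffM big1 // => -[a b] /= /eqP hm.
rewrite mcoeffX; case: eqP => [hb|]; last by rewrite mulr0.
case/negP: hd; rewrite hm mnmDE -hb mulmnE mnm1E eqxx mul1n leq_addl //.
Qed.

Lemma fcoef_zcoef (i : 'I_n) d F m : fcoef (zcoef i d F) m =
  if m i == 0%N then fcoef F (m + U_(i) *+ d)%MM else 0.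
Proof. by []. Qed.

Lemma fcoef_Dop (i : 'I_n) F m : fcoef (Dop i F) m =
  \sum_(d < (m i).+1) fcoef (zcoef i d F
    * (hsym d (1 :: [seq fpsX j | j : 'I_n <- enum 'I_n & (j < i)%N])
       * fpsX i ^+ d)) m.
Proof. by []. Qed.

Lemma DopXn (i : 'I_n) d (c : {fps R[n]}) :
    (forall m : 'X_{1..n}, m i != 0%N -> fcoef c m = 0) ->
  Dop i (c * fpsX i ^+ d) =
    c * (hsym d (1 :: [seq fpsX j | j : 'I_n <- enum 'I_n & (j < i)%N]) * fpsX i ^+ d).
Proof.
move=> hc.
have zE e : zcoef i e (c * fpsX i ^+ d) = if e == d then c else 0.
  apply/fpsP => m; rewrite fcoef_zcoef fcoefMXn mnmDE mulmnE mnm1E eqxx mul1n.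
  case: eqP => [mi|/eqP mi]; last by case: ifP => _ //; rewrite hc.
  rewrite mi add0n; case: (ltngtP d e) => [lt_de|//|->]; last by rewrite addmK.
  rewrite hc // mnmBE mnmDE !mulmnE mnm1E eqxx !mul1n mi add0n.
  by rewrite subn_eq0 -ltnNge.
apply/fpsP => m; rewrite fcoef_Dop.
have [hd|hd] := leqP d (m i).
  rewrite (bigD1 (inord d)) // inordK ?ltnS // zE eqxx big1 => [|e]; first exact: addr0.
  move=> ne; rewrite zE ifN ?mul0r //; apply: contraNneq ne => ed.
  by apply/eqP/val_inj; rewrite /= inordK ?ltnS.
rewrite mulrA fcoefMXn leqNgt hd big1 // => e _; rewrite zE.
by case: eqP (ltn_ord e) => [-> |]; rewrite ?mul0r // ltnS leqNgt hd.
Qed.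

Lemma Dop_is_linear (i : 'I_n) (a : R) F G :
  Dop i (fpsC a * F + G) = fpsC a * Dop i F + Dop i G.
Proof.
have zD e : zcoef i e (fpsC a * F + G) = fpsC a * zcoef i e F + zcoef i e G.
  apply/fpsP => m; rewrite fcoefD fcoefCM !fcoef_zcoef fcoefD fcoefCM.
  by case: eqP; rewrite ?mulr0 ?addr0.
apply/fpsP => m; rewrite fcoefD fcoefCM !fcoef_Dop mulr_sumr -big_split.
by apply: eq_bigr => e _; rewrite zD mulrDl -mulrA fcoefD fcoefCM.
Qed.

End DOperator.

(* x is the variable of the coefficient ring, and z_i is fpsX i. *)
Lemma denominator_unit (k l : nat)
    (x := fpsC (fpsX ord0) : {fps {fps int[1]}[l]}) :
  2 - hsym k (1 :: x :: [seq x * fpsX i | i : 'I_l <- enum 'I_l])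
    \is a GRing.unit.
Proof.
have x0 : fcst (fcst x) = 0.
  rewrite /fcst [fcoef x _]/= eqxx /=.
  by case: eqP => // /esym/eqP; rewrite mnm1_eq0.
set D := 2 - _; suff D1 : fcst (fcst D) = 1.
  by rewrite fps_unitE fps_unitE -[fcoef _ _]/(fcst (fcst D)) D1 unitr1.
have cB m (S : comNzRingType) (f g : {fps S[m]}) : fcst (f - g) = fcst f - fcst g.
  by [].
have c2 m (S : comNzRingType) : fcst (2 : {fps S[m]}) = 2 by exact: rmorph_nat.
have cM m (S : comNzRingType) (f g : {fps S[m]}) : fcst (f * g) = fcst f * fcst g.
  exact: fcoefM0.
have c1 m (S : comNzRingType) : fcst (1 : {fps S[m]}) = 1.
  by rewrite /fcst fcoef1 eqxx.
have ch m (S : comNzRingType) (s : seq {fps S[m]}) :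
    fcst (hsym k (1 :: s)) = hsym k (1 :: map (@fcst _ _) s).
  by rewrite [LHS](hsym_morph (@fcst m S)) map_cons [X in X :: _]c1.
have key m (S : comNzRingType) (s : seq {fps S[m]}) :
    fcst (2 - hsym k (1 :: s)) = 2 - hsym k (1 :: map (@fcst _ _) s).
  by rewrite -(c2 m S) -ch.
rewrite /D key key hsym10 //= x0 eqxx /=.
apply/allP => _ /mapP[_ /mapP[_ /mapP[i _ ->] ->] ->].
by rewrite !cM x0 mul0r.
Qed.

(* -------------------------------------------------------------------------- *)
(* Multiplex juggling cards. The function f : [s] -> {0} U [t] of a card is   *)
(* represented by the list throw = (f(1), ..., f(s)); lists are 0-based, so   *)
(* beta_(f(i)) is nth 0 beta (f(i)).-1.                                       *)
(* -------------------------------------------------------------------------- *)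

Record card := Card {
  arrival : seq nat;
  departure : seq nat;
  throw : seq nat }.

Definition card_tuple (C : card) := (arrival C, departure C, throw C).
Definition tuple_card (c : seq nat * seq nat * seq nat) :=
  Card c.1.1 c.1.2 c.2.
Fact card_tupleK : cancel card_tuple tuple_card. Proof. by case. Qed.
HB.instance Definition _ := Choice.copy card (can_type card_tupleK).

Local Open Scope nat_scope.

Definition composition (a : seq nat) : bool := all (fun p => 0 < p) a.

Definition is_card (C : card) : bool :=
  let: Card alpha beta f := C in
  [&& composition alpha, composition beta, sumn alpha == sumn beta,
      size f == size alpha, all (fun v => v <= size beta) f, sorted ltn f
    & [forall i : 'I_(size alpha), (nth 0 f i != 0) ==>
         (nth 0 alpha i <= nth 0 beta (nth 0 f i).-1)]].

Definition balls (C : card) : nat := sumn (arrival C).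

Definition has_capacity (k : nat) (C : card) : bool :=
  all (fun p => p <= k) (arrival C) && all (fun p => p <= k) (departure C).

Definition card_sequence (b k l : nat) (s : seq card) : bool :=
  [&& size s == l,
      all (fun C => [&& is_card C, balls C == b & has_capacity k C]) s
    & sorted (fun C C' => departure C == arrival C') s].

(* In a card with b balls the three lists have at most b entries, all of them *)
(* at most b, so that card sequences can be counted in a finite type.         *)
Definition bcard (b : nat) : finType :=
  ({bseq b of 'I_b.+1} * {bseq b of 'I_b.+1} * {bseq b of 'I_b.+1})%type.

Definition bcard_card b (C : bcard b) : card :=
  Card (map val C.1.1) (map val C.1.2) (map val C.2).

Definition J (b k l : nat) : nat :=
  #|[set s : l.-tuple (bcard b) | card_sequence b k l (map (@bcard_card b) s)]|.

Lemma size_composition a : composition a -> size a <= sumn a.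
Proof.
by elim: a => //= p a IH /andP[p0 /IH ha]; rewrite -add1n leq_add.
Qed.

Lemma leq_sumn a : all (fun p => p <= sumn a) a.
Proof.
elim: a => //= p a IH; rewrite leq_addr /=; apply: sub_all IH => q hq.
by rewrite (leq_trans hq) ?leq_addl.
Qed.

Lemma bseq_lift b (a : seq nat) : size a <= b -> all (fun p => p <= b) a ->
  exists u : {bseq b of 'I_b.+1}, a = map val u.
Proof.
move=> sa ba; have hs : size (map (@inord b) a) <= b by rewrite size_map.
exists (Bseq hs); rewrite /= -map_comp -[LHS]map_id; apply/eq_in_map => p pa.
by rewrite /= inordK // ltnS (allP ba).
Qed.

Lemma bcard_lift b C : is_card C -> balls C = b -> exists D : bcard b,
  C = bcard_card D.
Proof.
case: C => al be f /and5P[ca cb /eqP sab /eqP sf /and3P[vf _ _]].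
rewrite /balls /= => sb.
have sal : size al <= b by rewrite -sb size_composition.
have sbe : size be <= b by rewrite -sb sab size_composition.
have [u ->] : exists u : {bseq b of 'I_b.+1}, al = map val u.
  by apply: bseq_lift => //; rewrite -sb leq_sumn.
have [v ->] : exists v : {bseq b of 'I_b.+1}, be = map val v.
  by apply: bseq_lift => //; rewrite -sb sab leq_sumn.
have [w ->] : exists w : {bseq b of 'I_b.+1}, f = map val w.
  apply: bseq_lift; first by rewrite sf.
  by apply: sub_all vf => q hq; rewrite (leq_trans hq).
by exists (u, v, w).
Qed.

Lemma bcard_card_inj b : injective (@bcard_card b).
Proof.
have inj (u v : {bseq b of 'I_b.+1}) : map val u = map val v -> u = v.
  by move=> /(inj_map val_inj) /val_inj.
by move=> [[u v] w] [[u' v'] w'] [/inj-> /inj-> /inj->].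
Qed.

(* The bound built into bcard excludes no card sequence. *)
Lemma J_spec b k l : exists s : seq (seq card),
  [/\ uniq s, s =i card_sequence b k l & size s = J b k l].
Proof.
set A := [set s : l.-tuple (bcard b) |
            card_sequence b k l (map (@bcard_card b) s)].
exists [seq map (@bcard_card b) (s : l.-tuple _) | s <- enum A]; split.
- rewrite map_inj_uniq ?enum_uniq // => s t.
  by move=> /(inj_map (@bcard_card_inj b)) /val_inj.
- move=> s; apply/mapP/idP => [[t]|hs].
    by rewrite mem_enum inE => ht ->.
  have /and3P[/eqP sz /allP hall _] : card_sequence b k l s := hs.
  have [t def_s] : exists t : seq (bcard b), s = map (@bcard_card b) t.
    elim: s {hs sz} hall => [|C s IH] hall; first by exists [::].
    have /and3P[cC /eqP bC _] := hall C (mem_head _ _).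
    have [D ->] := bcard_lift cC bC.
    have [|t ->] := IH; last by exists (D :: t).
    by move=> E hE; apply: hall; rewrite inE hE orbT.
  have szt : size t == l by rewrite -sz def_s size_map.
  by exists (Tuple szt); rewrite ?mem_enum ?inE -?def_s.
- by rewrite size_map -cardE.
Qed.

(* Main.v *)
(* Read a card sequence from its last departure composition d backwards.  A card
   with departure d is determined by the sizes a_j <= d_j of the stacks absorbed
   by the departing stacks (0 for none): the missing c = |d| - |a| balls form the
   stack thrown from height 0, so the card exists in capacity k iff c <= k, and
   its arrival composition is c followed by a, zeros deleted.
   On the other side, expanding in the last variable,
     prod_j h_(d_j)(1,z_1..z_n) = sum_(a <= d) prod_j h_(a_j)(1,z_1..z_(n-1)) z_n^c,
   and the operator D_(z_1..z_n) turns z_n^c into h_c(1,z_1..z_(n-1)) z_n^c, while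
   the factor 1/(1-z_n) makes the extraction of z_n^k keep exactly the c <= k.
   Hence both sides obey the same recursion, and the number of n-card sequences
   with last departure d is the image of prod_j h_(d_j)(1,z_1..z_n).  Finally
   1/(2 - h_k(1,x,xz)) = sum_d x^|d| prod_j h_(d_j)(1,z), over the compositions d
   with parts at most k, because h_k(1,x,xz) - 1 = sum_(1<=p<=k) x^p h_p(1,z). *)

Require Import Defs.
From mathcomp Require Import all_boot all_order all_algebra.
From mathcomp Require Import mpoly.

Set Implicit Arguments.
Unset Strict Implicit.
Unset Printing Implicit Defensive.

Import GRing.Theory.
Local Open Scope ring_scope.

(** * Complete homogeneous symmetric polynomials *)

Section CompleteSymmetric.
Variable R : comNzRingType.
Implicit Types (s : seq R) (x y : R).

(** Distributing the product picks one exponent per factor, and these choices are exactly the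
    functions summed in [hsym]. *)
Lemma hsym_coef d s :
  hsym d s = (\prod_(y <- s) \poly_(e < d.+1) (y ^+ e))`_d.
Proof.
rewrite (big_nth 0) big_mkord.
under eq_bigr do rewrite poly_def.
rewrite bigA_distr_bigA coef_sum /hsym big_mkcond; apply: eq_bigr => f _ /=.
by rewrite scaler_prod prodrXr coefZ coefXn eq_sym; case: eqP; rewrite ?mulr1 ?mulr0.
Qed.

Lemma coef_prod_geometric D d s : (d <= D)%N ->
  (\prod_(y <- s) \poly_(e < D.+1) (y ^+ e))`_d = hsym d s.
Proof.
(* Frees the bound of the right-hand product from [d], so that the induction compares any two bounds
   at least [d]. *)
rewrite hsym_coef; have := leqnn d; move: {2 5}d => D'.
elim: s d => [|y s IH] d leD' leD; first by rewrite !big_nil.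
rewrite !big_cons !coefM; apply: eq_bigr => i _.
have le_id : (i <= d)%N by rewrite -ltnS.
rewrite !coef_poly !ltnS (leq_trans le_id leD) (leq_trans le_id leD').
by rewrite IH // (leq_trans (leq_subr _ _)).
Qed.

Lemma hsym_cons d y s :
  hsym d (y :: s) = \sum_(a < d.+1) y ^+ a * hsym (d - a) s.
Proof.
rewrite hsym_coef big_cons coefM; apply: eq_bigr => a _.
by rewrite coef_poly ltn_ord coef_prod_geometric ?leq_subr.
Qed.

Lemma perm_hsym d s t : perm_eq s t -> hsym d s = hsym d t.
Proof. by move=> st; rewrite !hsym_coef (perm_big _ st). Qed.

Lemma hsym_rcons d s y :
  hsym d (rcons s y) = \sum_(a < d.+1) hsym a s * y ^+ (d - a).
Proof.
rewrite (@perm_hsym _ _ (y :: s)) ?perm_rcons // hsym_cons.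
rewrite (reindex_inj rev_ord_inj); apply: eq_bigr => a _ /=.
by rewrite [RHS]mulrC subSS subKn // -ltnS.
Qed.

Lemma hsym0 s : hsym 0 s = 1.
Proof.
elim: s => [|y s IH]; first by rewrite hsym_coef big_nil coef1.
by rewrite hsym_cons big_ord1 IH mulr1.
Qed.

Lemma hsym_scale x d s : hsym d [seq x * y | y <- s] = x ^+ d * hsym d s.
Proof.
rewrite /hsym size_map mulr_sumr; apply: eq_bigr => e /eqP se.
have -> : x ^+ d = \prod_(i < size s) x ^+ e i by rewrite prodrXr se.
rewrite -big_split; apply: eq_bigr => i _.
by rewrite (nth_map 0) // exprMn.
Qed.

Lemma hsym_cons1 d s : hsym d (1 :: s) = \sum_(a < d.+1) hsym a s.
Proof.
rewrite hsym_cons (reindex_inj rev_ord_inj); apply: eq_bigr => a _ /=.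
by rewrite expr1n mul1r subSS subKn // -ltnS.
Qed.

End CompleteSymmetric.

(** * Cards with a given departure composition *)

Section Cards.
Variable k : nat.
Local Open Scope nat_scope.
Implicit Types (a d f : seq nat) (C : Defs.card).

Fixpoint subvectors d : seq (seq nat) :=
  if d is p :: d' then [seq q :: a | q <- index_iota 0 p.+1, a <- subvectors d']
  else [:: [::]].

Fixpoint support p a : seq nat :=
  if a is q :: a' then
    if 0 < q then p :: support p.+1 a' else support p.+1 a'
  else [::].

(* The arrival list of the card with departures [d] in which the j-th departing
   stack absorbs an arriving stack of size a_j (none if a_j = 0). *)
Definition arrivals d a : seq nat :=
  let c := sumn d - sumn a in
  if 0 < c then c :: filter (leq 1) a else filter (leq 1) a.

(** A throw value 0 marks the stack thrown from height 0; as throw values increase strictly, it can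
    only come first. *)
Definition card_of d a : Defs.card :=
  Card (arrivals d a) d
    (if 0 < sumn d - sumn a then 0 :: support 1 a else support 1 a).

Definition cards_to d : seq Defs.card :=
  [seq card_of d a | a <- subvectors d & sumn d - sumn a <= k].

Fixpoint card_sequences n d : seq (seq Defs.card) :=
  if n is n'.+1 then
    [seq rcons s C | C <- cards_to d, s <- card_sequences n' (arrival C)]
  else [:: [::]].

(** These are the compositions with exactly [r] parts, all at most [k]: the indices in the expansion
    of an [r]-th power. *)
Fixpoint words r : seq (seq nat) :=
  if r is r'.+1 then [seq p :: w | p <- index_iota 1 k.+1, w <- words r']
  else [:: [::]].

(** * Subvectors and supports *)

Lemma subvectors_cons p d :
  subvectors (p :: d) =
    [seq q :: a | q <- index_iota 0 p.+1, a <- subvectors d].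
Proof. by []. Qed.

Lemma subvectors_uniq d : uniq (subvectors d).
Proof.
elim: d => // p d IH; apply: (allpairs_uniq (iota_uniq 0 (p.+1 - 0)) IH).
by move=> [q a] [q' a'] _ _ [-> ->].
Qed.

Lemma mem_subvectors d a : (a \in subvectors d) = all2 leq a d.
Proof.
elim: d a => [|p d IH] a; first by case: a.
rewrite subvectors_cons; case: a => [|q a].
  by apply/allpairsPdep => -[? [? []]].
rewrite [all2 _ _ _]/= -IH.
apply/allpairsPdep/andP => [[q' [a' [q'p ha [-> ->]]]]|[qp ha]].
  by split=> //; move: q'p; rewrite mem_index_iota.
by exists q, a; rewrite mem_index_iota.
Qed.

Lemma subvector_sumn d a : all2 leq a d -> sumn a <= sumn d.
Proof. by elim: d a => [|p d IH] [|q a] //= /andP[qp /IH]; apply: leq_add. Qed.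

Lemma subvector_size d a : all2 leq a d -> size a = size d.
Proof. by rewrite all2E => /andP[/eqP]. Qed.

Lemma subvector_bounded d a :
  all2 leq a d -> all (geq k) d -> all (geq k) a.
Proof.
elim: d a => [|p d IH] [|q a] //= /andP[qp /IH h] /andP[pk /h ->].
by rewrite (leq_trans qp).
Qed.

Lemma sumn_filter a : sumn (filter (leq 1) a) = sumn a.
Proof. by elim: a => //= -[|q] a /= ->. Qed.

Lemma support_ge p a : all (leq p) (support p a).
Proof.
elim: a p => //= q a IH p.
have h : all (leq p) (support p.+1 a) by apply: sub_all (IH p.+1) => j /ltnW.
by case: ifP; rewrite //= leqnn.
Qed.

Lemma support_le p a : all (fun j => j < p + size a) (support p a).
Proof.
elim: a p => //= q a IH p; have := IH p.+1; rewrite addSnnS => h.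
by case: ifP; rewrite //= addnS ltnS leq_addr -addnS.
Qed.

Lemma support_sorted p a : sorted ltn (support p a).
Proof.
elim: a p => //= q a IH p; case: ifP => // _ /=.
by rewrite path_min_sorted ?IH ?support_ge.
Qed.

Lemma size_support p a : size (support p a) = size (filter (leq 1) a).
Proof. by elim: a p => //= q a IH p; case: ifP => //= _; rewrite IH. Qed.

(** The i-th positive entry of [a] sits at the i-th position of its support, so the bound by [d]
    there is the card condition on absorbed stacks. *)
Lemma nth_support_le p a d i : all2 leq a d -> i < size (support p a) ->
  nth 0 (filter (leq 1) a) i <= nth 0 d (nth 0 (support p a) i - p).
Proof.
elim: a p d i => [|q a IH] p [|e d] i //= /andP[qe ad].
have shift j : j < size (support p.+1 a) ->
    nth 0 (support p.+1 a) j - p = (nth 0 (support p.+1 a) j - p.+1).+1.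
  by move=> hj; rewrite subnSK //; exact: (allP (support_ge p.+1 a)) (mem_nth _ hj).
case: ifP => hq /= hi.
  case: i hi => [|i] /= hi; first by rewrite subnn.
  by rewrite shift //=; exact: IH.
by rewrite shift //=; exact: IH.
Qed.

(** This tells a positive head from a zero one and, with [p] equal to 0, a card with a thrown stack
    from one without. *)
Lemma support_succ_neq p a f : p :: f <> support p.+1 a.
Proof. by move=> e; have := support_ge p.+1 a; rewrite -e /= ltnn. Qed.

Lemma filter_support_inj p a a' : size a = size a' ->
  filter (leq 1) a = filter (leq 1) a' -> support p a = support p a' -> a = a'.
Proof.
elim: a p a' => [|q a IH] p [|q' a'] //= [sz].
case: (posnP q) => [->|_]; case: (posnP q') => [->|_] /=.
- by move=> e1 e2; rewrite (IH p.+1 a').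
- by move=> _ /esym /support_succ_neq.
- by move=> _ /support_succ_neq.
- by move=> -[-> e1] [e2]; rewrite (IH p.+1 a').
Qed.

(** Scatter the entries of [al] to the positions in [f] and put zeros elsewhere. The induction walks
    along [d], asking at position [p] whether [f] starts there. *)
Lemma exists_subvector p d al f :
  composition al -> size f = size al -> sorted ltn f ->
  all (fun j => p <= j < p + size d) f ->
  (forall i, i < size al -> nth 0 al i <= nth 0 d (nth 0 f i - p)) ->
  exists a, [/\ all2 leq a d, filter (leq 1) a = al & support p a = f].
Proof.
elim: d p al f => [|e d IH] p al f.
  case: f => [|q f] /=; last first.
    by rewrite addn0 => _ _ _ /andP[/andP[/leq_ltn_trans h /h]]; rewrite ltnn.
  by case: al => // _ _ _ _ _; exists [::].
case: f al => [|q f] [|r al] //=.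
  move=> _ _ _ _ _; have [] := IH p.+1 [::] [::] => // a [ha hf hs].
  by exists (0 :: a).
move=> /andP[r0 cal] [sz] pf /andP[/andP[pq qd] hf] hle.
have sf := path_sorted pf.
have qf : all (ltn q) f by apply: order_path_min pf => ? ? ?; apply: ltn_trans.
have [eq_pq|ne_pq] := eqVneq q p.
  have [|i hi|a [ha hfa hsa]] := IH p.+1 al f cal sz sf.
  - apply/allP => j jf; have lt_qj : q < j := allP qf j jf.
    rewrite -eq_pq lt_qj /=.
    by have := allP hf j jf; rewrite addSnnS eq_pq => /andP[].
  - have := hle i.+1 hi; rewrite /= -[_ - p]prednK // ?subn_gt0 -?eq_pq.
      by rewrite -subnS.
    by apply: (allP qf); rewrite mem_nth ?sz.
  have := hle 0 isT; rewrite /= eq_pq subnn /= => re.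
  by exists (r :: a); rewrite /= re r0 ha hfa hsa.
have lt_pq : p < q by rewrite ltn_neqAle eq_sym ne_pq.
have hq : all (fun j => p < j) (q :: f).
  by rewrite /= lt_pq; apply: sub_all qf => j; apply: ltn_trans.
have [||||i hi|a [ha hfa hsa]] := IH p.+1 (r :: al) (q :: f).
- by rewrite /= r0.
- by rewrite /= sz.
- by [].
- apply/allP => j jf; rewrite (allP hq j jf) addSnnS.
  have /allP /(_ j jf) : all (fun j => p <= j < p + (size d).+1) (q :: f).
    by rewrite /= pq qd.
  by case/andP.
- have := hle i hi; rewrite /= -[nth 0 (q :: f) i - p]prednK ?subn_gt0.
    by rewrite -subnS.
  by apply: (allP hq); rewrite mem_nth //= sz.
by exists (0 :: a); rewrite /= ha hfa hsa.
Qed.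

(** * The bijection between cards and subvectors of their departure *)

Lemma cards_to_uniq d : uniq (cards_to d).
Proof.
rewrite map_inj_in_uniq; first by rewrite filter_uniq ?subvectors_uniq.
move=> a a'; rewrite !mem_filter !mem_subvectors.
move=> /andP[_ /subvector_size sza] /andP[_ /subvector_size sza'].
have sz : size a = size a' by rewrite sza sza'.
rewrite /card_of /arrivals; case: ifP; case: ifP => _ _ [].
- by move=> _ ef es; apply: filter_support_inj es.
- by move=> _ /support_succ_neq.
- by move=> _ /esym/support_succ_neq.
- by move=> ef es; apply: filter_support_inj es.
Qed.

Lemma is_card_balls C : is_card C -> balls C = sumn (departure C).
Proof. by case: C => al be f /and5P[_ _ /eqP]. Qed.

Lemma is_card_card_of d a : composition d -> all2 leq a d ->
  is_card (card_of d a).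
Proof.
move=> cd ad; have le_ad := subvector_sumn ad.
have sza : size a = size d by apply: subvector_size.
have hs := support_le 1 a; rewrite sza in hs.
have ca : composition (filter (leq 1) a) by apply: filter_all.
rewrite /card_of /arrivals; case: ifPn => [c0|].
  apply/and5P; split; rewrite /= ?c0 //.
  - by rewrite sumn_filter subnK.
  - by rewrite size_support.
  - apply/and3P; split=> //; first by rewrite path_min_sorted ?support_sorted ?support_ge.
    apply/forallP => -[[|i] hi] //=; apply/implyP => _.
    by rewrite -subn1 nth_support_le // size_support.
rewrite -eqn0Ngt subn_eq0 => le_da.
apply/and5P; split=> //.
- by rewrite sumn_filter eqn_leq le_ad.
- by rewrite size_support.
- apply/and3P; split=> //; first exact: support_sorted.
  apply/forallP => -[i hi] /=; apply/implyP => _.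
  by rewrite -subn1 nth_support_le // size_support.
Qed.

Lemma is_card_card_ofP C : is_card C ->
  exists2 a, all2 leq a (departure C) & C = card_of (departure C) a.
Proof.
case: C => al be f /and5P[cal cbe /eqP sal /eqP sf /and3P[hf pf /forallP hle]].
have {}hle i : i < size al -> nth 0 f i != 0 ->
    nth 0 al i <= nth 0 be (nth 0 f i - 1).
  by move=> hi; rewrite subn1; have /implyP := hle (Ordinal hi).
(* By strict increase a zero in [f] is its head; the first arrival is then the thrown stack, and the
   others are scattered over [be]. *)
have [f0|f0] := boolP (0 \in f).
  case: f f0 sf hf pf hle => // j f; case: al cal sal => // c al.
  move=> /andP[c0 cal] /= sal f0 [sf] /andP[_ hf] pf hle.
  have qf : all (ltn j) f.
    by apply: order_path_min pf => ? ? ?; apply: ltn_trans.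
  have j0 : j = 0 by move: f0; rewrite inE => /predU1P[|/(allP qf)].
  subst j.
  have [||i hi|a [ha hfa hsa]] := exists_subvector (p := 1) (d := be) cal sf.
  - exact: path_sorted pf.
  - apply/allP => j jf; have lt0j : 0 < j := allP qf j jf.
    by rewrite lt0j add1n ltnS (allP hf).
  - apply: (hle i.+1 hi); rewrite -lt0n.
    by apply: (allP qf); apply: mem_nth; rewrite sf.
  exists a => //; rewrite /card_of /arrivals -sal -(sumn_filter a) hfa hsa.
  by rewrite addnK c0.
have pos j : j \in f -> 0 < j.
  by move=> jf; rewrite lt0n; apply: contraNneq f0 => <-.
have [||i hi|a [ha hfa hsa]] := exists_subvector (p := 1) (d := be) cal sf.
- by [].
- by apply/allP => j jf; rewrite pos // add1n ltnS (allP hf).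
- by apply: hle => //; rewrite -lt0n pos // mem_nth ?sf.
exists a => //.
by rewrite /card_of /arrivals -sal -(sumn_filter a) hfa hsa subnn.
Qed.

(** Absorbed stacks inherit the bound [k] from [d], so capacity only constrains the thrown stack. *)
Lemma mem_cards_to d C : composition d -> all (geq k) d ->
  (C \in cards_to d) = [&& departure C == d, is_card C & has_capacity k C].
Proof.
move=> cd kd; apply/mapP/and3P => [[a]|[/eqP <- /is_card_card_ofP[a ha defC] hk]].
  rewrite mem_filter mem_subvectors => /andP[ck ad] ->; split=> //.
    exact: is_card_card_of.
  rewrite /has_capacity /= kd andbT /arrivals.
  have ka : all (geq k) (filter (leq 1) a).
    apply/allP => q; rewrite mem_filter => /andP[_].
    by apply/allP; apply: subvector_bounded kd.
  by case: ifP => //= _; rewrite ck.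
exists a => //; rewrite mem_filter mem_subvectors ha andbT.
move: hk; rewrite defC /has_capacity /= /arrivals => /andP[hk _].
by case: posnP hk => [->|_ /andP[]].
Qed.

(** * Card sequences with prescribed last departure *)

Lemma size_card_sequences n d :
  size (card_sequences n.+1 d) =
    \sum_(a <- subvectors d | sumn d - sumn a <= k)
      size (card_sequences n (arrivals d a)).
Proof. by rewrite size_allpairs_dep sumnE !big_map big_filter. Qed.

Lemma card_sequences_uniq n d : uniq (card_sequences n d).
Proof.
elim: n d => //= n IH d; apply: allpairs_uniq_dep => //.
  exact: cards_to_uniq.
by move=> [C s] [C' s'] _ _ /= /rcons_inj[-> ->].
Qed.

(** The dummy card at the end acts through its arrival list alone: it forces the last departure to
    be [d] and imposes nothing on the empty sequence. *)
Lemma mem_card_sequences n d s : composition d -> all (geq k) d ->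
  (s \in card_sequences n d) =
    [&& size s == n,
        all (fun C => [&& is_card C, balls C == sumn d & has_capacity k C]) s
      & sorted (fun C C' => departure C == arrival C')
          (rcons s (Card d d [::]))].
Proof.
set r := fun C C' : Defs.card => departure C == arrival C'.
(* Peeling off the last card turns its arrival list into the terminal condition for the rest. *)
have sorted_rcons2 t C E : sorted r (rcons (rcons t C) E) =
    sorted r (rcons t (Card (arrival C) (arrival C) [::])) && r C E.
  by case: t => [|D t] /=; rewrite ?andbT // !rcons_path last_rcons.
elim: n d s => [|n IH] d s cd kd.
  by rewrite inE; case: s.
apply/allpairsPdep/idP => [[C [t [hC ht ->]]]|].
  move: hC; rewrite mem_cards_to // => /and3P[/eqP dC cC kC].
  have bC : sumn (arrival C) = sumn d by rewrite -dC -is_card_balls.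
  have [caC kaC] : composition (arrival C) /\ all (geq k) (arrival C).
    by case: (C) cC kC => ? ? ? /and5P[? _ _ _ _] /andP[].
  move: ht; rewrite IH // bC => /and3P[/eqP <- ht st].
  rewrite size_rcons all_rcons sorted_rcons2 st ht cC kC /r /= dC.
  by rewrite [balls C]bC !eqxx.
case/lastP: s => // t C; rewrite size_rcons eqSS all_rcons sorted_rcons2.
case/and4P=> szt /andP[/and3P[cC /eqP bC kC] ht] st /eqP dC.
have [caC kaC] : composition (arrival C) /\ all (geq k) (arrival C).
  by case: (C) cC kC => ? ? ? /and5P[? _ _ _ _] /andP[].
exists C, t; split=> //; first by rewrite mem_cards_to // dC eqxx cC kC.
by rewrite IH // szt st -[sumn _]/(balls C) bC ht.
Qed.

Lemma card_sequences_last n d s : 0 < n -> s \in card_sequences n d ->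
  exists t C, s = rcons t C /\ departure C = d.
Proof. by case: n => // n _ /allpairsPdep[C [t [/mapP[a _ ->] _ ->]]]; exists t, (card_of d a). Qed.

Lemma words_cons r :
  words r.+1 = [seq p :: w | p <- index_iota 1 k.+1, w <- words r].
Proof. by []. Qed.

Lemma words_uniq r : uniq (words r).
Proof.
elim: r => // r IH; apply: allpairs_uniq => //; first exact: iota_uniq.
by move=> [q a] [q' a'] _ _ [-> ->].
Qed.

Lemma mem_words r d :
  (d \in words r) = [&& size d == r, composition d & all (geq k) d].
Proof.
elim: r d => [|r IH] d; first by case: d.
rewrite words_cons; apply/allpairsPdep/idP => [[p [w []]]|].
  rewrite mem_index_iota ltnS IH => /andP[p0 pk] /and3P[/eqP <- cw kw] -> /=.
  by rewrite eqxx p0 pk cw kw.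
case: d => [|p d] //=; rewrite eqSS => /and3P[sz /andP[p0 cd] /andP[pk kd]].
by exists p, d; rewrite mem_index_iota p0 ltnS IH sz cd.
Qed.

(** Sequences are grouped by the departure of their last card, which exists as [l] is positive. It
    is a composition of [b], so it has at most [b] parts, whence the range of [r]. *)
Lemma J_sum b l : 0 < l ->
  J b k l = \sum_(r < b.+1) \sum_(d <- words r | sumn d == b)
              size (card_sequences l d).
Proof.
move=> l0; have [s [us ms <-]] := J_spec b k l.
pose D := [seq d | r <- iota 0 b.+1, d <- [seq d <- words r | sumn d == b]].
have mD d : (d \in D) = [&& composition d, all (geq k) d & sumn d == b].
  apply/allpairsPdep/and3P => [[r [e []]]|[cd kd /eqP sd]].
    by rewrite mem_filter mem_words => _ /and4P[? _ ? ?] ->.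
  exists (size d), d; rewrite mem_iota ltnS -sd size_composition //.
  by rewrite mem_filter mem_words !eqxx cd kd.
have uD : uniq D.
  apply: allpairs_uniq_dep; first exact: iota_uniq.
    by move=> r _; rewrite filter_uniq ?words_uniq.
  move=> [r d] [r' d'] /allpairsPdep[? [? [_ h [-> ->]]]].
  move=> /allpairsPdep[? [? [_ h' [-> ->]]]] /= e; move: h h'; rewrite -e.
  by rewrite !mem_filter !mem_words => /and4P[_ /eqP -> _ _] /and4P[_ /eqP ->].
pose S := [seq t | d <- D, t <- card_sequences l d].
have uS : uniq S.
  apply: allpairs_uniq_dep => //; first by move=> d _; apply: card_sequences_uniq.
  move=> [d t] [d' t'] /allpairsPdep[e [u [he hu [-> ->]]]].
  move=> /allpairsPdep[e' [u' [he' hu' [-> ->]]]] /= eu.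
  (* The groups are disjoint because a nonempty sequence determines its last departure. *)
  suff ee : e = e' by rewrite eu ee.
  rewrite -eu in hu'.
  have [v [C [eqC <-]]] := card_sequences_last l0 hu.
  have [v' [C' [eqC' <-]]] := card_sequences_last l0 hu'.
  by move: eqC'; rewrite eqC => /rcons_inj[_ ->].
have mS t : (t \in s) = (t \in S).
  rewrite ms; apply/and3P/allpairsPdep => [[/eqP szt ht st]|[d [u [hd hu ->]]]].
    case/lastP: t szt ht st => [sz0|t C]; first by move: l0; rewrite -sz0.
    move=> szt ht st; have := ht; rewrite all_rcons => /andP[/and3P[cC bC kC] _].
    have [caC kaC] : composition (departure C) /\ all (geq k) (departure C).
      by case: (C) cC kC => ? ? ? /and5P[_ ? _ _ _] /andP[].
    have dC := is_card_balls cC.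
    exists (departure C), (rcons t C); split=> //.
      by rewrite mD caC kaC -dC bC.
    rewrite mem_card_sequences // szt eqxx -dC (eqP bC) ht /=.
    by case: (t) st => [|E v] /=; rewrite ?eqxx // !rcons_path last_rcons => ->; rewrite eqxx.
  move: hd hu; rewrite mD => /and3P[cd kd /eqP <-].
  rewrite mem_card_sequences // => /and3P[szu hu su]; split=> //.
  by case: (u) su => //= E v; rewrite rcons_path => /andP[].
rewrite (perm_size (uniq_perm us uS mS)) size_allpairs_dep sumnE big_map.
rewrite big_allpairs_dep -[iota 0 b.+1]/(index_iota 0 b.+1) big_mkord.
by apply: eq_bigr => r _; rewrite big_filter.
Qed.



End Cards.

(** * The operators D and the extraction of the diagonal coefficient *)

Section SeriesOperators.
Variable l : nat.

Section Ring.
Variable R : comNzRingType.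
Implicit Types (F G : {fps R[l]}) (i j n : 'I_l) (m : 'X_{1..l}).

(** * Independence of a variable, and its interaction with the operators *)

Definition free_of n F := forall m, m n != 0%N -> fcoef F m = 0.

Lemma free_of_sum n I (r : seq I) (P : pred I) (F : I -> {fps R[l]}) :
  (forall a, P a -> free_of n (F a)) -> free_of n (\sum_(a <- r | P a) F a).
Proof. by move=> hF m mn; rewrite fcoef_sum big1 // => a Pa; apply: hF. Qed.

Lemma free_ofM n F G : free_of n F -> free_of n G -> free_of n (F * G).
Proof.
move=> hF hG m mn; rewrite fcoefM big1 // => -[p q] /= /eqP def_m.
have [pn|pn] := eqVneq (bmnm p n) 0%N; last by rewrite hF ?mul0r.
rewrite hG ?mulr0 //; apply: contraNneq mn => qn.
by have /mnmP/(_ n) -> := def_m; rewrite mnmDE pn qn.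
Qed.

Lemma free_of1 n : free_of n 1.
Proof. by move=> m; rewrite fcoef1; case: (m =P 0%MM) => [->|]; rewrite ?mnm0E. Qed.

Lemma free_of_prod n I (r : seq I) (P : pred I) (F : I -> {fps R[l]}) :
  (forall a, P a -> free_of n (F a)) -> free_of n (\prod_(a <- r | P a) F a).
Proof.
by move=> hF; elim/big_ind: _ => //; [apply: free_of1|move=> ? ?; apply: free_ofM].
Qed.

Lemma free_ofX n F e : free_of n F -> free_of n (F ^+ e).
Proof.
by move=> hF; rewrite -[e]card_ord -prodr_const; apply: free_of_prod.
Qed.

Lemma free_of_fpsX n i : i != n -> free_of n (fpsX i).
Proof.
move=> ne m /=; case: (m =P U_(i)%MM) => [->|//].
by rewrite mnm1E (negbTE ne).
Qed.

Lemma free_of_hsym n d (s : seq {fps R[l]}) :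
  (forall F, F \in s -> free_of n F) -> free_of n (hsym d s).
Proof.
move=> hs; apply: free_of_sum => e _; apply: free_of_prod => a _.
by apply: free_ofX; apply: hs; rewrite mem_nth.
Qed.

Definition variables_below (n : nat) : seq {fps R[l]} :=
  [seq fpsX j | j : 'I_l <- enum 'I_l & (j < n)%N].

Lemma free_of_variables n e F :
  (e <= n)%N -> F \in 1 :: variables_below e -> free_of n F.
Proof.
move=> le_en; rewrite inE => /predU1P[->|/mapP[j]]; first exact: free_of1.
rewrite mem_filter => /andP[lt_je _] ->; apply: free_of_fpsX.
by apply: contraTneq (leq_trans lt_je le_en) => ->; rewrite ltnn.
Qed.

(** [Dop i] multiplies only by series in variables of index at most [i]. *)
Lemma Dop_free n i F : (i < n)%N -> free_of n F -> free_of n (Dop i F).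
Proof.
move=> lt_in hF m mn; rewrite fcoef_Dop big1 // => d _.
have ne_in : i != n by apply: contraTneq lt_in => ->; rewrite ltnn.
suff: free_of n (zcoef i d F * (hsym d (1 :: variables_below i) * fpsX i ^+ d)).
  by apply.
apply: free_ofM; last first.
  apply: free_ofM; last by apply: free_ofX; apply: free_of_fpsX.
  by apply: free_of_hsym => G; apply: free_of_variables; apply: ltnW.
move=> u un; rewrite fcoef_zcoef; case: eqP => // _; apply: hF.
by rewrite mnmDE mulmnE mnm1E (negbTE ne_in) mul0n addn0.
Qed.

(** [Dop i] acts coefficientwise in z_i, so powers of another variable are constants for its
    extraction of coefficients. *)
Lemma DopMXn n i c F : i != n ->
  Dop i (F * fpsX n ^+ c) = Dop i F * fpsX n ^+ c.
Proof.
move=> ne; have zM d : zcoef i d (F * fpsX n ^+ c) = zcoef i d F * fpsX n ^+ c.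
  apply/fpsP => m; rewrite fcoefMXn !fcoef_zcoef !fcoefMXn.
  rewrite mnmBE mnmDE !mulmnE !mnm1E (eq_sym n) (negbTE ne) !mul0n addn0 subn0.
  case: eqP => _; case: ifP => // le_c; congr (fcoef F _).
  apply/mnmP => j; rewrite !(mnmDE, mnmBE, mulmnE, mnm1E).
  have [<-|] := eqVneq n j; last by rewrite !mul0n !subn0.
  by rewrite (negbTE ne) mul0n !addn0.
apply/fpsP => m; rewrite fcoefMXn !fcoef_Dop.
transitivity (\sum_(d < (m i).+1) fcoef (zcoef i d F *
   (hsym d (1 :: variables_below i) * fpsX i ^+ d) * fpsX n ^+ c) m).
  by apply: eq_bigr => d _; rewrite zM mulrAC.
case: ifPn => le_c; last first.
  by rewrite big1 // => d _; rewrite fcoefMXn (negbTE le_c).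
rewrite mnmBE mulmnE mnm1E eq_sym (negbTE ne) mul0n subn0.
by apply: eq_bigr => d _; rewrite fcoefMXn le_c.
Qed.

Lemma DopD i F G : Dop i (F + G) = Dop i F + Dop i G.
Proof. by have := Dop_is_linear i 1 F G; rewrite !mul1r. Qed.

Lemma Dop0 i : Dop i (0 : {fps R[l]}) = 0.
Proof. by apply: (addrI (Dop i 0)); rewrite -DopD !addr0. Qed.

Lemma DopC i c F : Dop i (fpsC c * F) = fpsC c * Dop i F.
Proof. by have := Dop_is_linear i c F 0; rewrite Dop0 !addr0. Qed.

(* The composite D_{z_1,z_2} ... D_{z_1,...,z_n} in the 1-based notation of the
   paper. *)
Definition Dops (n : nat) F :=
  foldr (fun i G => Dop i G) F [seq i : 'I_l <- enum 'I_l | (0 < i < n)%N].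

Lemma DopsD (n : nat) F G : Dops n (F + G) = Dops n F + Dops n G.
Proof. by rewrite /Dops; elim: [seq _ <- _ | _] => //= i s ->; rewrite DopD. Qed.

Lemma DopsC (n : nat) c F : Dops n (fpsC c * F) = fpsC c * Dops n F.
Proof. by rewrite /Dops; elim: [seq _ <- _ | _] => //= i s ->; rewrite DopC. Qed.

Lemma Dops_free n F : free_of n F -> free_of n (Dops n F).
Proof.
rewrite /Dops => hF.
have /allP : all (fun i : 'I_l => i < n)%N [seq i : 'I_l <- enum 'I_l | (0 < i < n)%N].
  by apply/allP => i; rewrite mem_filter => /andP[/andP[]].
elim: [seq _ <- _ | _] => //= i s IH h; apply: Dop_free; first by rewrite h ?mem_head.
by apply: IH => j js; rewrite h // inE js orbT.
Qed.

Lemma DopsMXn n c F : Dops n (F * fpsX n ^+ c) = Dops n F * fpsX n ^+ c.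
Proof.
rewrite /Dops.
have /allP : all (fun i : 'I_l => i < n)%N [seq i : 'I_l <- enum 'I_l | (0 < i < n)%N].
  by apply/allP => i; rewrite mem_filter => /andP[/andP[]].
elim: [seq _ <- _ | _] => //= i s IH h; rewrite IH => [|j js].
  by rewrite DopMXn //; apply: contraTneq (h i (mem_head _ _)) => ->; rewrite ltnn.
by rewrite h // inE js orbT.
Qed.

Lemma filter_ordS n :
  [seq j : 'I_l <- enum 'I_l | (j < n.+1)%N] =
    rcons [seq j : 'I_l <- enum 'I_l | (j < n)%N] n.
Proof.
have val_filter e : (e <= l)%N ->
    map val [seq j : 'I_l <- enum 'I_l | (j < e)%N] = iota 0 e.
  move=> le_el.
  transitivity [seq j <- map val (enum 'I_l) | (j < e)%N]; first by rewrite filter_map.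
  rewrite val_enum_ord.
  rewrite -(subnKC le_el) iotaD filter_cat add0n.
  rewrite (eq_in_filter (a2 := xpredT)) ?filter_predT; last first.
    by move=> j; rewrite mem_iota.
  rewrite (eq_in_filter (a2 := pred0)) ?filter_pred0 ?cats0 // => j.
  by rewrite mem_iota => /andP[le_ej _]; rewrite ltnNge le_ej.
apply: (inj_map val_inj); rewrite map_rcons !val_filter //; last exact: ltnW.
by rewrite -[n.+1]addn1 iotaD cats1.
Qed.

Lemma variables_belowS n : variables_below n.+1 = rcons (variables_below n) (fpsX n).
Proof. by rewrite /variables_below filter_ordS map_rcons. Qed.

Lemma DopsS n F : (0 < n)%N -> Dops n.+1 F = Dops n (Dop n F).
Proof.
move=> n0; rewrite /Dops.
have fE e : [seq i : 'I_l <- enum 'I_l | (0 < i < e)%N] =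
    [seq i : 'I_l <- [seq i : 'I_l <- enum 'I_l | (i < e)%N] | (0 < i)%N].
  by rewrite -filter_predI.
by rewrite !fE filter_ordS filter_rcons n0 foldr_rcons.
Qed.

Lemma Dops1 F : Dops 1 F = F.
Proof.
rewrite /Dops (eq_filter (a2 := pred0)) ?filter_pred0 // => i /=.
by case: (i : nat).
Qed.

Lemma Dops0 F : Dops 0 F = F.
Proof.
rewrite /Dops (eq_filter (a2 := pred0)) ?filter_pred0 // => i /=.
by rewrite andbF.
Qed.

(** [Dop n] is applied first and treats [F] as a constant; the power of z_n then passes through the
    remaining operators. *)
Lemma Dops_step n c F : free_of n F ->
  Dops n.+1 (F * fpsX n ^+ c) =
    Dops n (F * hsym c (1 :: variables_below n)) * fpsX n ^+ c.
Proof.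
move=> hF; have [n0|n0] := posnP n.
  (* [Dops] has no operator for the first variable; the formula still holds because h_c(1) = 1. *)
  rewrite n0 Dops1 Dops0 /variables_below (eq_filter (a2 := pred0)) //.
  by rewrite filter_pred0 hsym10 // mulr1.
by rewrite DopsS // DopXn // mulrA DopsMXn.
Qed.

Lemma Dops_at0 (n : nat) : Dops n (0 : {fps R[l]}) = 0.
Proof. by apply: (addrI (Dops n 0)); rewrite -DopsD !addr0. Qed.

Lemma Dops_sum (n : nat) I (r : seq I) (P : pred I) (F : I -> {fps R[l]}) :
  Dops n (\sum_(a <- r | P a) F a) = \sum_(a <- r | P a) Dops n (F a).
Proof. exact: (big_morph _ (@DopsD n) (Dops_at0 n)). Qed.

End Ring.

(** * Geometric factors and diagonal extraction *)

Section UnitRing.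
Variable R : comUnitRingType.
Implicit Types (F G : {fps R[l]}) (i j n : 'I_l) (m : 'X_{1..l}).

(** An exact finite expansion replaces the infinite series: when a variable divides [x], the
    remainder misses any fixed coefficient for large [N]. *)
Lemma geometric_remainder (A : comUnitRingType) (x : A) N :
  1 - x \is a GRing.unit -> 1 / (1 - x) = \sum_(j < N) x ^+ j + x ^+ N / (1 - x).
Proof.
move=> ux; apply: (mulIr ux); rewrite mulrDl !divrK //.
by rewrite mulrC -opprB mulNr -subrX1 opprB subrK.
Qed.

Lemma unit_1subfpsX i : 1 - fpsX i \is a @GRing.unit {fps R[l]}.
Proof.
rewrite fps_unitE fcoefB fcoef1 eqxx [fcoef (fpsX i) _]/= eq_sym.
by rewrite mnm1_eq0 subr0 unitr1.
Qed.

Lemma fcoef_geometric i F m :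
  fcoef (1 / (1 - fpsX i) * F) m =
    \sum_(j < (m i).+1) fcoef F (m - U_(i) *+ j)%MM.
Proof.
rewrite (geometric_remainder (m i).+1 (unit_1subfpsX i)) mulrDl fcoefD.
rewrite -mulrA [X in _ + fcoef X _]mulrC fcoefMXn ltnn addr0.
rewrite mulr_suml fcoef_sum; apply: eq_bigr => j _.
by rewrite mulrC fcoefMXn -ltnS ltn_ord.
Qed.

(** Of all lowerings of the exponent of z_n, only the one that removes z_n altogether can meet a
    term of [F]. *)
Lemma fcoef_geometric_free n F m : free_of n F ->
  fcoef (1 / (1 - fpsX n) * F) m = fcoef F (m - U_(n) *+ m n)%MM.
Proof.
move=> hF; rewrite fcoef_geometric big_ord_recr /= big1 ?add0r // => j _.
by apply: hF; rewrite mnmBE mulmnE mnm1E eqxx mul1n subn_eq0 -ltnNge ltn_ord.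
Qed.

Lemma free_of_geometric n i : i != n -> free_of n (1 / (1 - fpsX i) : {fps R[l]}).
Proof.
move=> ne m mn; rewrite -[_ / _]mulr1 fcoef_geometric big1 // => j _.
by apply: (@free_of1 _ n); rewrite mnmBE mulmnE mnm1E (negbTE ne) subn0.
Qed.

Lemma fcoef_prod_geometric (r : seq 'I_l) m : uniq r ->
    (forall i, i \notin r -> m i = 0%N) ->
  fcoef (\prod_(i <- r) (1 / (1 - fpsX i)) : {fps R[l]}) m = 1.
Proof.
elim: r m => [|i r IH] m /=.
  move=> _ m0; rewrite big_nil fcoef1 (_ : m = 0%MM) ?eqxx //.
  by apply/mnmP => i; rewrite m0 // mnm0E.
move=> /andP[ir ur] hm; rewrite big_cons fcoef_geometric_free; last first.
  rewrite big_seq; apply: free_of_prod => j jr; apply: free_of_geometric.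
  by apply: contraNneq ir => <-.
apply: IH => // j jr; rewrite mnmBE mulmnE mnm1E.
have [->|ne] := eqVneq i j; first by rewrite mul1n subnn.
by rewrite hm // inE eq_sym (negbTE ne).
Qed.

Variable k : nat.

Definition diag_coef F : R :=
  fcoef ((\prod_(i < l) (1 / (1 - fpsX i))) * F) [multinom k | i < l].

Lemma diag_coefD F G : diag_coef (F + G) = diag_coef F + diag_coef G.
Proof. by rewrite /diag_coef mulrDr fcoefD. Qed.

Lemma diag_coef0 : diag_coef 0 = 0.
Proof. by rewrite /diag_coef mulr0. Qed.

Lemma diag_coef_sum I (r : seq I) (P : pred I) (F : I -> {fps R[l]}) :
  diag_coef (\sum_(a <- r | P a) F a) = \sum_(a <- r | P a) diag_coef (F a).
Proof. exact: (big_morph _ diag_coefD diag_coef0). Qed.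

Lemma diag_coefC c F : diag_coef (fpsC c * F) = c * diag_coef F.
Proof. by rewrite /diag_coef mulrCA fcoefCM. Qed.

Lemma diag_coef1 : diag_coef 1 = 1.
Proof.
rewrite /diag_coef mulr1 fcoef_prod_geometric ?index_enum_uniq // => i.
by rewrite mem_index_enum.
Qed.

Lemma diag_coefMXn n c F : free_of n F ->
  diag_coef (F * fpsX n ^+ c) = if (c <= k)%N then diag_coef F else 0.
Proof.
move=> hF; have prodE : \prod_(i < l) (1 / (1 - fpsX i)) =
    1 / (1 - fpsX n) * \prod_(i < l | i != n) (1 / (1 - fpsX i)) :> {fps R[l]}.
  by rewrite (bigD1 n).
rewrite /diag_coef prodE !mulrA -!(mulrA _ _ F).
set E := _ * F; have hE : free_of n E.
  by apply: free_ofM => //; apply: free_of_prod => i; apply: free_of_geometric.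
rewrite fcoefMXn mnmE; case: ifP => // le_ck.
(* Both sides are the coefficient of [E] at the diagonal monomial without z_n: lowering by [c] and
   then by [k - c] is lowering by [k]. *)
rewrite !fcoef_geometric_free //; congr (fcoef E _); apply/mnmP => j.
rewrite !(mnmBE, mulmnE, mnm1E, mnmE) eqxx mul1n.
by case: eqP => _; rewrite ?mul1n ?mul0n ?subn0 // -subnDA subnKC.
Qed.

End UnitRing.

End SeriesOperators.

(** * The recursion and the generating function *)

Section Assembly.
Variables (k l : nat).

(** Each part gives up some of its degree to [y]; the degrees kept for [s] form a subvector, and
    those given up add up to the exponent of [y]. *)
Lemma prod_hsym_rcons (A : comNzRingType) (s : seq A) y d :
  \prod_(p <- d) hsym p (rcons s y) =
    \sum_(a <- subvectors d)
      (\prod_(q <- a) hsym q s) * y ^+ (sumn d - sumn a).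
Proof.
elim: d => [|p d IH]; first by rewrite big_seq1 !big_nil mulr1.
rewrite big_cons IH hsym_rcons subvectors_cons big_allpairs_dep mulr_suml.
rewrite -(big_mkord xpredT (fun a => hsym a s * y ^+ (p - a) * _)).
rewrite big_seq [RHS]big_seq; apply: eq_bigr => q.
rewrite mem_index_iota ltnS /= => le_qp.
rewrite mulr_sumr big_seq [RHS]big_seq; apply: eq_bigr => a.
rewrite mem_subvectors => /subvector_sumn le_ad.
by rewrite big_cons /= subnDA addnC -addnBA // -addnBAC // addnC exprD mulrACA.
Qed.

(** Deleted zeros contribute h_0 = 1, so the result of one operator step is again a product over a
    departure list, that of the preceding card. *)
Lemma prod_hsym_arrivals (A : comNzRingType) (s : seq A) d a :
  \prod_(q <- arrivals d a) hsym q s =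
    (\prod_(q <- a) hsym q s) * hsym (sumn d - sumn a) s.
Proof.
have filterE : \prod_(q <- filter (leq 1) a) hsym q s = \prod_(q <- a) hsym q s.
  rewrite big_filter big_mkcond; apply: eq_bigr => q _.
  by case: q => //; rewrite hsym0.
rewrite /arrivals; case: posnP => [->|_]; first by rewrite filterE hsym0 mulr1.
by rewrite big_cons filterE mulrC.
Qed.

(** Induction on [n] runs [prod_hsym_rcons] and [size_card_sequences] in parallel over the
    subvectors of [d]; [diag_coefMXn] supplies the capacity test. *)
Lemma diag_coef_Dops_prod (R : comUnitRingType) n d : (n <= l)%N ->
  diag_coef k (Dops n (\prod_(p <- d) hsym p (1 :: variables_below l R n))) =
    (size (card_sequences k n d))%:R.
Proof.
elim: n d => [|n IH] d le_nl.
  rewrite Dops0 big1 ?diag_coef1 // => p _.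
  rewrite /variables_below (eq_filter (a2 := pred0)) //.
  by rewrite filter_pred0 hsym10.
pose i := Ordinal le_nl; rewrite -[n]/(nat_of_ord i) variables_belowS -rcons_cons.
rewrite prod_hsym_rcons Dops_sum.
rewrite diag_coef_sum.
rewrite size_card_sequences natr_sum [RHS]big_mkcond.
apply: eq_bigr => a _.
set P := \prod_(q <- a) _.
have freeP : free_of i P.
  by apply: free_of_prod => q _; apply: free_of_hsym => G; apply: free_of_variables.
have freeH c : free_of i (hsym c (1 :: variables_below l R i)).
  by apply: free_of_hsym => G; apply: free_of_variables.
rewrite Dops_step // diag_coefMXn; last by apply: Dops_free; apply: free_ofM.
by case: ifP => // _; rewrite -prod_hsym_arrivals IH // ltnW.
Qed.

Lemma diag_coef_Dops_scale (R : comUnitRingType) n (c : R) j (F : {fps R[l]}) :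
  diag_coef k (Dops n (fpsC c ^+ j * F)) = c ^+ j * diag_coef k (Dops n F).
Proof.
elim: j => [|j IH]; first by rewrite !mul1r.
by rewrite !exprS -!mulrA DopsC diag_coefC IH.
Qed.

Lemma power_sum_words (A : comNzRingType) (x : A) (s : seq A) r :
  (\sum_(1 <= p < k.+1) x ^+ p * hsym p s) ^+ r =
    \sum_(d <- words k r) x ^+ sumn d * \prod_(p <- d) hsym p s.
Proof.
elim: r => [|r IH]; first by rewrite big_seq1 big_nil mulr1.
rewrite exprS IH words_cons big_allpairs_dep mulr_suml; apply: eq_bigr => p _.
by rewrite mulr_sumr; apply: eq_bigr => d _; rewrite big_cons exprD mulrACA.
Qed.

Lemma two_sub_hsym (A : comNzRingType) (x : A) (s : seq A) :
  2 - hsym k (1 :: x :: [seq x * y | y <- s]) =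
    1 - \sum_(1 <= p < k.+1) x ^+ p * hsym p (1 :: s).
Proof.
(* Writing the entry [x] as x times 1 lets homogeneity act on the whole list. *)
have -> : x :: [seq x * y | y <- s] = [seq x * y | y <- 1 :: s].
  by rewrite /= mulr1.
rewrite hsym_cons1 -(big_mkord xpredT (fun a => hsym a _)) big_nat_recl //.
rewrite hsym0 big_add1 opprD addrA -[2]/(1 + 1 :> A) addrK; congr (_ - _).
by apply: eq_bigr => p _; rewrite hsym_scale.
Qed.

Lemma fcoef_fpsX_exp_natr (A : comNzRingType) j q (m : 'X_{1..1}) :
  fcoef (fpsX ord0 ^+ j * q%:R : {fps A[1]}) m =
    if j == m ord0 then q%:R else 0.
Proof.
have fcoef_natr u : fcoef (q%:R : {fps A[1]}) u = (u == 0%MM)%:R *+ q.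
  by elim: q => [|q IH]; rewrite ?mulr0n // !mulrSr fcoefD IH fcoef1.
rewrite mulrC fcoefMXn; case: ltngtP => [lt_jm|//|eq_jm].
  rewrite fcoef_natr; case: eqP => [/mnmP/(_ ord0)|]; last by rewrite mul0rn.
  by rewrite mnmBE mulmnE mnm1E eqxx mul1n mnm0E => /eqP; rewrite subn_eq0 leqNgt lt_jm.
rewrite fcoef_natr (_ : _ == _) //; apply/eqP/mnmP => i.
by rewrite (ord1 i) mnmBE mulmnE mnm1E eqxx mul1n mnm0E eq_jm subnn.
Qed.

End Assembly.

Theorem theorem4p5 (k l : nat) (hk : (0 < k)%N) (hl : (0 < l)%N) :
  let x : {fps {fps int[1]}[l]} := fpsC (fpsX ord0) in
  let z : 'I_l -> {fps {fps int[1]}[l]} := fun i => fpsX i in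
  genser (fun b => (J b k l)%:Z) =
  fcoef
    ((\prod_(i < l) (1 / (1 - z i))) *
     foldr (fun i F => Dop i F)
       (1 / (2 - hsym k (1 :: x :: [seq x * z i | i : 'I_l <- enum 'I_l])))
       [seq i : 'I_l <- enum 'I_l | (0 < i)%N])
    [multinom k | i < l].
Proof.
move=> x z.
(* Inserting the vacuous bound [i < l] lets the operators of the statement be read as [Dops l]. *)
have filter_lt (P : pred nat) :
    [seq i : 'I_l <- enum 'I_l | P i && (i < l)%N] = [seq i : 'I_l <- enum 'I_l | P i].
  by apply: eq_filter => i; rewrite ltn_ord andbT.
have varsE : [seq x * z i | i <- enum 'I_l] =
    [seq x * y | y <- variables_below l {fps int[1]} l].
  rewrite /variables_below (filter_lt xpredT) filter_predT.
  by rewrite -[RHS]map_comp.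
have : 2 - hsym k (1 :: x :: [seq x * z i | i <- enum 'I_l]) \is a GRing.unit.
  exact: denominator_unit.
rewrite varsE two_sub_hsym.
set T := \sum_(1 <= p < _) _ => unit_den.
rewrite -(filter_lt (fun i => 0 < i)%N) -/(Dops l _) -/(diag_coef k _).
apply/fpsP => m; rewrite [LHS]/=; set b := m ord0.
(* The sum [T] starts at exponent 1, so x divides it and the remainder after the powers up to [b] is
   a multiple of x^(b+1). *)
have [U defT] : exists U, T = x * U.
  exists (\sum_(1 <= p < k.+1) x ^+ p.-1 * hsym p (1 :: variables_below l _ l)).
  rewrite mulr_sumr /T big_nat [RHS]big_nat; apply: eq_bigr => -[|p] // _.
  by rewrite mulrA -exprS.
rewrite (geometric_remainder b.+1 unit_den) DopsD diag_coefD fcoefD.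
rewrite [X in _ = _ + X](_ : _ = 0) ?addr0; last first.
  rewrite {1}defT exprMn -mulrA diag_coef_Dops_scale.
  by rewrite mulrC fcoefMXn ltnn.
rewrite Dops_sum.
rewrite diag_coef_sum fcoef_sum.
(* The [r]-th power of [T] accounts for the last departures with [r] parts. *)
rewrite J_sum // -[(_ : nat)%:Z]natz natr_sum; apply: eq_bigr => r _.
rewrite power_sum_words Dops_sum.
rewrite diag_coef_sum fcoef_sum.
rewrite natr_sum big_mkcond; apply: eq_bigr => d _.
(* Here x is a scalar for the operators, and taking the coefficient of x^b keeps the [d] of size
   [b]. *)
rewrite diag_coef_Dops_scale diag_coef_Dops_prod // fcoef_fpsX_exp_natr.
by [].
Qed.
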